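(* Let $M$ be a valuated matroid on a finite set $E$. Let $\mathcal{S}$ be the $\mathbb{R}_{\max}$-module of finitely generated flats of $M$. Then $\mathcal{S}$ is canonically isomorphic to $Q_M$ as an $\mathbb{R}_{\max}$-module; that is, there is a (unique) isomorphism of $\mathbb{R}_{\max}$-modules $Q_M\to\mathcal{S}$ sending the class of $x$ to $\mathrm{cl}(\{x\})$ for every $x\in E$.
   Context: $\mathbb{R}_{\max}=\mathbb{R}\cup\{-\infty\}$ with addition $\max$ and multiplication the usual addition of reals, written multiplicatively; zero $-\infty$, unit $1$ (the real number $0$), $\mathbb{R}_{\max}^\times=\mathbb{R}$. An $\mathbb{R}_{\max}$-module is a commutative monoid with an action of $\mathbb{R}_{\max}$ satisfying the usual module axioms. Valuated matroid on a finite set $E$ (circuit description): a collection $\mathcal{C}\subseteq \mathbb{R}_{\max}^E$ of functions, called circuits, such that, writing $\underline{X}=\{e\in E\mid X(e)\ne-\infty\}$: the constant function $-\infty$ is not in $\mathcal{C}$; if $X,Y\in\mathcal{C}$ and $\underline X\neq\underline Y$ then $\underline X\not\subseteq\underline Y$; if $X\in\mathcal{C}$ and $a\in\mathbb{R}_{\max}^\times$ then $aX\in\mathcal{C}$; and for $X,Y\in\mathcal{C}$ and $u,v\in E$ with $X(u)=Y(u)\neq-\infty$ and $X(v)>Y(v)$ there is $Z\in\mathcal{C}$ with $Z(u)=-\infty$, $Z(v)=X(v)$ and $Z\le\max(X,Y)$ pointwise. $\hat M$ is $\mathbb{R}_{\max}\times E$ with $\{-\infty\}\times E$ collapsed to one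 point $\mathbf 0$; the class of $(a,x)$ is written $ax$, and $x\in E$ is identified with $1x$. Partial order: $ax\le by$ iff both are $\mathbf 0$, or $x=y$ and $a\le b$ (so $\mathbf 0\le bx$). A circuit set is $\{c(x)x\mid c(x)\neq-\infty\}$ for a circuit $c$. A flat is a nonempty downward closed $F\subseteq\hat M$ such that for every circuit set $C$ and $u\in C$, $C\setminus\{u\}\subseteq F$ implies $u\in F$. $\mathrm{cl}(S)$ is the intersection of all flats containing $S$; a flat is finitely generated if it is the closure of a finite set. Module structure on $\mathcal{S}$: $F+F'=F\vee F'=\mathrm{cl}(F\cup F')$, $aF=\{au\mid u\in F\}$ for $a\in\mathbb{R}_{\max}^\times$, and $(-\infty)F=\mathrm{cl}(\emptyset)$, the zero element. $Q_M$ is the quotient of the free $\mathbb{R}_{\max}$-module on $E$ by the congruence generated by the relations $\sum_{y\in E}c(y)y=\sum_{y\in E\setminus\{x\}}c(y)y$ for every circuit $c$ of $M$ and every $x\in E$. *)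

(* Defs.v *)
From HB Require Import structures.
From mathcomp Require Import all_boot all_order all_algebra.
From mathcomp Require Import boolp classical_sets cardinality reals.

Set Implicit Arguments.
Unset Strict Implicit.
Unset Printing Implicit Defensive.

Import Order.TTheory GRing.Theory Num.Theory.
Local Open Scope classical_set_scope.
Local Open Scope ring_scope.
Local Open Scope quotient_scope.

(* The semifield R u {-oo}: [None] is -oo.  In [ring_scope], [+] is max, [*] is
   the addition of R, [0] is -oo, [1] is the real number 0, and [<=] is the
   usual order. *)
Definition maxplus (R : realType) : Type := option R.

Section MaxPlus.
Variable R : realType.
Implicit Types a b c : maxplus R.

HB.instance Definition _ := Choice.copy (maxplus R) (option R).

Definition mp_le a b : bool :=
  match a, b with
  | None, _ => true
  | Some _, None => false
  | Some r, Some s => r <= s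
  end.

Definition mp_lt a b : bool := (b != a) && mp_le a b.

Fact mp_le_anti : antisymmetric mp_le.
Proof. by move=> [r|] [s|] //= /le_anti ->. Qed.

Fact mp_le_trans : transitive mp_le.
Proof. by move=> [s|] [r|] [t|] //=; apply: le_trans. Qed.

Fact mp_le_total : total mp_le.
Proof. by move=> [r|] [s|] //=; apply: le_total. Qed.

HB.instance Definition _ :=
  Order.isOrder.Build ring_display (maxplus R)
    (fun _ _ => erefl) (fun _ _ => erefl) (fun _ _ => erefl)
    mp_le_anti mp_le_trans mp_le_total.

Fact mp_add0 : left_id (None : maxplus R) Order.max.
Proof. by move=> a; apply/max_idPr. Qed.

HB.instance Definition _ := GRing.isNmodule.Build (maxplus R)
  maxA maxC mp_add0.

Definition mp_mul a b : maxplus R :=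
  match a, b with
  | Some r, Some s => Some (r + s)
  | _, _ => None
  end.

Definition mp_one : maxplus R := Some 0.

Fact mp_mulA : associative mp_mul.
Proof. by move=> [r|] [s|] [t|] //=; rewrite addrA. Qed.

Fact mp_mulC : commutative mp_mul.
Proof. by move=> [r|] [s|] //=; rewrite addrC. Qed.

Fact mp_mul1 : left_id mp_one mp_mul.
Proof. by move=> [r|] //=; rewrite add0r. Qed.

Fact mp_mul_le c a b : a <= b -> mp_mul c a <= mp_mul c b.
Proof. by move: c a b => [r|] [s|] [t|] //=; rewrite /Order.le/= lerD2l. Qed.

Fact mp_mulDl : left_distributive mp_mul (@Order.max _ (maxplus R)).
Proof.
move=> a b c; rewrite !(mp_mulC _ c).
case: (leP a b) => [ab|/ltW ba].
  by apply/esym/max_idPr/mp_mul_le.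
by apply/esym/max_idPl/mp_mul_le.
Qed.

Fact mp_mul0 : left_zero (None : maxplus R) mp_mul.
Proof. by []. Qed.

Fact mp_one_neq0 : mp_one != 0.
Proof. by []. Qed.

HB.instance Definition _ := GRing.Nmodule_isComNzSemiRing.Build (maxplus R)
  mp_mulA mp_mulC mp_mul1 mp_mulDl mp_mul0 mp_one_neq0.

End MaxPlus.

(* The free module R_max^E; [^o] makes R_max a module over itself, so that the
   pointwise module structure of finite functions applies. *)
Notation mp_fun R E := {ffun E -> (maxplus R)^o}.

Definition mp_supp (R : realType) (E : finType) (X : mp_fun R E) : set E :=
  [set e | X e != 0].

Record valuated_matroid (R : realType) (E : finType) := ValuatedMatroid {
  circuits : set (mp_fun R E);
  circuits_neq0 : ~ circuits 0;
  circuits_supp : forall X Y, circuits X -> circuits Y ->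
    mp_supp X <> mp_supp Y -> ~ (mp_supp X `<=` mp_supp Y);
  circuits_scale : forall X (a : maxplus R), circuits X -> a != 0 ->
    circuits (a *: X);
  circuits_elim : forall X Y u v, circuits X -> circuits Y ->
    X u = Y u -> X u != 0 -> Y v < X v ->
    exists Z, [/\ circuits Z, Z u = 0, Z v = X v &
      forall e, Z e <= Order.max (X e) (Y e)]
}.

(* R_max x E with {-oo} x E collapsed to the point [None]; the pairs [(r, x)]
   with r finite are left untouched.  [hat_pt a x] is the class of (a, x).
   The collapsed point is present even when E is empty. *)
Definition hat (R : realType) (E : finType) : Type := option (R * E).

Section Hat.
Variables (R : realType) (E : finType).
Implicit Types (u v w : hat R E) (a b : maxplus R) (x y : E).

Definition hat0 : hat R E := None.

Definition hat_pt a x : hat R E :=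
  if a is Some r then Some (r, x) else hat0.

Definition hat_le u v : Prop :=
  (u = hat0 /\ v = hat0) \/
  exists x a b, [/\ u = hat_pt a x, v = hat_pt b x & a <= b].

Definition hat_scale a u : hat R E :=
  if u is Some (r, x) then hat_pt (a * (Some r : maxplus R)) x else hat0.

Lemma hat_pt_eq a b x y :
  hat_pt a x = hat_pt b y <-> (a = 0 /\ b = 0) \/ (a = b /\ x = y).
Proof.
split; last by case=> [[-> ->] //|[-> ->] //].
by case: a b => [r|] [s|] //=; [move=> [-> ->]; right|left].
Qed.

Lemma hat_ptP u : u = hat0 \/ exists a x, a != 0 /\ u = hat_pt a x.
Proof. by case: u => [[r x]|]; [right; exists (Some r), x|left]. Qed.

Lemma hat_scale_pt a b x : hat_scale a (hat_pt b x) = hat_pt (a * b) x.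
Proof. by case: b => [s|] //; case: a. Qed.

Lemma hat_scaleA a b u : hat_scale a (hat_scale b u) = hat_scale (a * b) u.
Proof.
case: (hat_ptP u) => [->|[c [x [_ ->]]]] //.
by rewrite !hat_scale_pt mulrA.
Qed.

Lemma hat_scale1 u : hat_scale 1 u = u.
Proof.
by case: (hat_ptP u) => [->|[c [x [_ ->]]]] //; rewrite hat_scale_pt mul1r.
Qed.

Lemma hat_scale_le a u v : hat_le u v -> hat_le (hat_scale a u) (hat_scale a v).
Proof.
case=> [[-> ->]|[x [b [c [-> -> bc]]]]]; first by left.
right; exists x, (a * b), (a * c); rewrite !hat_scale_pt; split => //.
exact: mp_mul_le.
Qed.

End Hat.

Section Flats.
Variables (R : realType) (E : finType) (M : valuated_matroid R E).
Implicit Types (F G S : set (hat R E)).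

Definition circuit_set (c : mp_fun R E) : set (hat R E) :=
  [set u | exists2 x, c x != 0 & u = hat_pt (c x) x].

Definition is_flat F : Prop :=
  [/\ F !=set0,
      forall u v, hat_le u v -> F v -> F u &
      forall c u, circuits M c -> circuit_set c u -> circuit_set c `\ u `<=` F -> F u].

Definition cl S : set (hat R E) :=
  \bigcap_(F in [set F | is_flat F /\ S `<=` F]) F.

Definition finitely_generated F : Prop := exists2 S, finite_set S & F = cl S.

Record fgflat := FGFlat {
  fgflat_set :> set (hat R E);
  fgflat_flat : is_flat fgflat_set;
  fgflat_fg : finitely_generated fgflat_set
}.

HB.instance Definition _ := gen_eqMixin fgflat.
HB.instance Definition _ := gen_choiceMixin fgflat.

Lemma fgflat_inj (F G : fgflat) : F = G :> set _ -> F = G.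
Proof.
case: F G => [F f1 f2] [G g1 g2] /= FG; move: f1 f2 g1 g2; rewrite FG.
by move=> *; congr FGFlat; apply: Prop_irrelevance.
Qed.

Lemma flat0 F : is_flat F -> F (hat0 R E).
Proof.
case=> -[u Fu] Fdown _; apply: Fdown Fu.
case: (hat_ptP u) => [->|[a [x [_ ->]]]]; first by left.
by right; exists x, 0, a.
Qed.

Lemma flat_cl S : is_flat (cl S).
Proof.
split=> [|u v uv Sv F [fF SF]|c u Mc cu cS F [fF SF]].
- by exists (hat0 R E) => F [/flat0].
- by case: (fF) => _ Fd _; apply: Fd uv _; apply: Sv.
- by case: (fF) => _ _ Fc; apply: (Fc c) => // w /cS; apply.
Qed.

Lemma sub_cl S : S `<=` cl S.
Proof. by move=> u Su F [_]; apply. Qed.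

Lemma cl_min S F : is_flat F -> S `<=` F -> cl S `<=` F.
Proof. by move=> fF SF u; apply. Qed.

Lemma cl_flat F : is_flat F -> cl F = F.
Proof. by move=> fF; apply/seteqP; split; [exact: cl_min|exact: sub_cl]. Qed.

Lemma le_cl S T : S `<=` T -> cl S `<=` cl T.
Proof.
by move=> ST; apply: cl_min; [exact: flat_cl|exact: subset_trans (@sub_cl T)].
Qed.

Lemma clU S T : cl (cl S `|` cl T) = cl (S `|` T).
Proof.
apply/seteqP; split.
  apply: cl_min; first exact: flat_cl.
  by rewrite subUset; split; apply: le_cl => u; [left|right].
by apply: le_cl => u [Su|Tu]; [left|right]; apply: sub_cl.
Qed.

Lemma flat_preim (a : maxplus R) F :
  a != 0 -> is_flat F -> is_flat (hat_scale a @^-1` F).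
Proof.
move=> a0 fF; have [Fn Fd Fc] := fF; split.
- by exists (hat0 R E); exact: (flat0 fF).
- by move=> u v /(hat_scale_le a)/Fd; apply.
move=> c _ Mc [x cx0 ->] cF; rewrite /= hat_scale_pt.
have acE y : (a *: c) y = a * c y by rewrite ffunE.
have ac0 y : (a *: c) y != 0 -> c y != 0.
  by rewrite acE; apply: contraNneq => ->; rewrite mulr0.
apply: (Fc (a *: c)); first exact: circuits_scale.
  exists x; last by rewrite acE.
  by rewrite acE; case: (a) (c x) a0 cx0 => [?|] [?|].
move=> _ [[y acy0 ->] yx]; rewrite acE -hat_scale_pt.
apply: cF; split; first by exists y => //; apply: ac0.
by move=> yxE; apply: yx; rewrite /= acE -!hat_scale_pt yxE.
Qed.

Lemma mp_inv (a : maxplus R) : a != 0 -> exists2 b, b != 0 & b * a = 1.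
Proof.
case: a => [r|//] _; exists (Some (- r)) => //.
by congr Some; rewrite addNr.
Qed.

Lemma image_scaleE (a b : maxplus R) F : b * a = 1 ->
  hat_scale a @` F = hat_scale b @^-1` F.
Proof.
move=> ba; apply/seteqP; split=> [_ [u Fu <-]|u Fu] /=.
  by rewrite hat_scaleA ba hat_scale1.
by exists (hat_scale b u) => //; rewrite hat_scaleA mulrC ba hat_scale1.
Qed.

Lemma flat_image (a : maxplus R) F :
  a != 0 -> is_flat F -> is_flat (hat_scale a @` F).
Proof.
move=> /mp_inv[b b0 ba] fF; rewrite (image_scaleE _ ba); exact: flat_preim.
Qed.

Lemma cl_image (a : maxplus R) S : a != 0 ->
  hat_scale a @` cl S = cl (hat_scale a @` S).
Proof.
move=> a0; have [b b0 ba] := mp_inv a0; apply/seteqP; split.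
  move=> _ [u Su <-].
  suff : cl S `<=` hat_scale a @^-1` cl (hat_scale a @` S) by apply.
  apply: cl_min; first by apply: flat_preim => //; apply: flat_cl.
  by move=> v Sv; apply: sub_cl; exists v.
apply: cl_min; first by apply: flat_image => //; apply: flat_cl.
by apply: image_subset; apply: sub_cl.
Qed.

Lemma fg_cl S : finite_set S -> finitely_generated (cl S).
Proof. by move=> fS; exists S. Qed.

Definition fgflat_zero : fgflat :=
  FGFlat (flat_cl set0) (fg_cl (finite_set0 _)).

Fact fgflat_join_fg (F G : fgflat) : finitely_generated (cl (F `|` G)).
Proof.
case: (fgflat_fg F) (fgflat_fg G) => [S fS ->] [T fT ->].
by rewrite clU; apply: fg_cl; rewrite finite_setU.
Qed.

Definition fgflat_join (F G : fgflat) : fgflat :=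
  FGFlat (flat_cl (F `|` G)) (fgflat_join_fg F G).

Definition fgflat_scale_set (a : maxplus R) (F : fgflat) : set (hat R E) :=
  if a == 0 then cl set0 else hat_scale a @` F.

Fact fgflat_scale_flat a (F : fgflat) : is_flat (fgflat_scale_set a F).
Proof.
rewrite /fgflat_scale_set; case: eqVneq => [_|a0]; first exact: flat_cl.
exact: flat_image a0 (fgflat_flat F).
Qed.

Fact fgflat_scale_fg a (F : fgflat) : finitely_generated (fgflat_scale_set a F).
Proof.
rewrite /fgflat_scale_set; case: eqVneq => [_|a0]; first exact/fg_cl.
case: (fgflat_fg F) => S fS ->; rewrite cl_image//.
exact/fg_cl/finite_image.
Qed.

Definition fgflat_scale a (F : fgflat) : fgflat :=
  FGFlat (fgflat_scale_flat a F) (fgflat_scale_fg a F).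

Fact fgflat_joinA : associative fgflat_join.
Proof.
move=> F G H; apply: fgflat_inj => /=.
rewrite -{1}(cl_flat (fgflat_flat F)) -{2}(cl_flat (fgflat_flat H)).
by rewrite !clU setUA.
Qed.

Fact fgflat_joinC : commutative fgflat_join.
Proof. by move=> F G; apply: fgflat_inj; rewrite /= setUC. Qed.

Fact fgflat_join0 : left_id fgflat_zero fgflat_join.
Proof.
move=> F; apply: fgflat_inj => /=.
by rewrite -{1}(cl_flat (fgflat_flat F)) clU set0U cl_flat//; apply: fgflat_flat.
Qed.

HB.instance Definition _ :=
  GRing.isNmodule.Build fgflat fgflat_joinA fgflat_joinC fgflat_join0.

Lemma mp_mul_neq0 (a b : maxplus R) : a != 0 -> b != 0 -> a * b != 0.
Proof. by case: a b => [?|] [?|]. Qed.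

Fact fgflat_scaleA a b (F : fgflat) :
  fgflat_scale a (fgflat_scale b F) = fgflat_scale (a * b) F.
Proof.
apply: fgflat_inj; rewrite /= /fgflat_scale_set.
case: (eqVneq a 0) => [->|a0]; first by rewrite mul0r eqxx.
case: (eqVneq b 0) => [b0|b0].
  rewrite b0 mulr0 eqxx /= /fgflat_scale_set eqxx.
  by rewrite cl_image// image_set0.
rewrite (negbTE (mp_mul_neq0 a0 b0)) /= /fgflat_scale_set (negbTE b0).
by rewrite image_comp; apply: eq_imagel => u _; rewrite /= hat_scaleA.
Qed.

Fact fgflat_scale0 (F : fgflat) : fgflat_scale 0 F = 0.
Proof. by apply: fgflat_inj; rewrite /= /fgflat_scale_set eqxx. Qed.

Fact fgflat_scale1 : left_id 1 fgflat_scale.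
Proof.
move=> F; apply: fgflat_inj; rewrite /= /fgflat_scale_set oner_eq0.
by rewrite (eq_imagel (f' := id)) ?image_id// => u _; rewrite hat_scale1.
Qed.

Fact fgflat_scaleDr : right_distributive fgflat_scale +%R.
Proof.
move=> a F G; case: (eqVneq a 0) => [->|a0].
  by rewrite !fgflat_scale0 add0r.
apply: fgflat_inj; rewrite /= /fgflat_scale_set (negbTE a0) cl_image//.
by rewrite image_setU.
Qed.

Lemma fgflat_scale_le (a b : maxplus R) (F : fgflat) : a <= b ->
  fgflat_scale a F `<=` fgflat_scale b F.
Proof.
rewrite /= /fgflat_scale_set; case: (eqVneq a 0) => [_ _|a0 ab].
  have := fgflat_scale_flat b F; rewrite /fgflat_scale_set => /cl_min; exact.
have b0 : b != 0 by case: (a) (b) a0 ab => [?|] [?|].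
rewrite (negbTE b0) => _ [u Fu <-].
have [_ + _] := flat_image b0 (fgflat_flat F).
apply; last by exists u; first exact: Fu.
case: (hat_ptP u) => [->|[c [x [_ ->]]]]; first by left.
right; exists x, (a * c), (b * c); rewrite !hat_scale_pt; split => //.
by rewrite ![_ * c]mulrC; apply: mp_mul_le.
Qed.

Lemma fgflat_join_idPr (F G : fgflat) : F `<=` G -> F + G = G.
Proof.
move=> /setUidPr FG; apply: fgflat_inj => /=.
by rewrite FG cl_flat//; apply: fgflat_flat.
Qed.

Fact fgflat_scaleDl (F : fgflat) : {morph fgflat_scale^~ F : a b / a + b}.
Proof.
move=> a b; have -> : a + b = Order.max a b by [].
case: (leP a b) => [ab|/ltW ba].
  by rewrite fgflat_join_idPr//; apply: fgflat_scale_le.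
by rewrite addrC fgflat_join_idPr//; apply: fgflat_scale_le.
Qed.

HB.instance Definition _ := GRing.Nmodule_isLSemiModule.Build (maxplus R) fgflat
  fgflat_scaleA fgflat_scale0 fgflat_scale1 fgflat_scaleDr fgflat_scaleDl.

End Flats.

Record congruence (S : pzSemiRingType) (V : lSemiModType S)
    (r : V -> V -> Prop) : Prop := Congruence {
  cong_refl : forall f, r f f;
  cong_sym : forall f g, r f g -> r g f;
  cong_trans : forall f g h, r f g -> r g h -> r f h;
  cong_add : forall f g f' g', r f g -> r f' g' -> r (f + f') (g + g');
  cong_scale : forall a f g, r f g -> r (a *: f) (a *: g)
}.

Section QuotientModule.
Variables (S : pzSemiRingType) (V : lSemiModType S) (r : V -> V -> Prop).

Definition gen_congruence (f g : V) : Prop :=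
  forall s : V -> V -> Prop, congruence s -> (forall f g, r f g -> s f g) ->
    s f g.

Lemma gen_congruenceP : congruence gen_congruence.
Proof.
split=> [f|f g fg|f g h fg gh|f g f' g' fg fg'|a f g fg] s sc rs.
- exact: cong_refl.
- by apply: cong_sym => //; apply: fg.
- by apply: (cong_trans sc) (fg _ sc rs) (gh _ sc rs).
- by apply: cong_add => //; [exact: fg|exact: fg'].
- by apply: cong_scale => //; apply: fg.
Qed.

Definition gen_congruenceb (f g : V) : bool := `[< gen_congruence f g >].

Fact gen_congruenceb_refl : reflexive gen_congruenceb.
Proof. by move=> f; apply/asboolP; apply: (cong_refl gen_congruenceP). Qed.

Fact gen_congruenceb_sym : symmetric gen_congruenceb.
Proof.
by move=> f g; apply/asboolP/asboolP; apply: (cong_sym gen_congruenceP).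
Qed.

Fact gen_congruenceb_trans : transitive gen_congruenceb.
Proof.
move=> g f h /asboolP fg /asboolP gh; apply/asboolP.
exact: (cong_trans gen_congruenceP) fg gh.
Qed.

Canonical gen_congruenceb_equiv :=
  EquivRel gen_congruenceb
    gen_congruenceb_refl gen_congruenceb_sym gen_congruenceb_trans.

Definition qmod : Type := {eq_quot gen_congruenceb}.

HB.instance Definition _ := Choice.on qmod.
HB.instance Definition _ := Quotient.on qmod.

Lemma qmodP (f g : V) : \pi_qmod f = \pi_qmod g <-> gen_congruence f g.
Proof.
split; first by move=> /eqmodP/asboolP.
by move=> fg; apply/eqmodP/asboolP.
Qed.

Definition qmod_zero : qmod := \pi_qmod 0.
Definition qmod_add (p q : qmod) : qmod := \pi_qmod (repr p + repr q).
Definition qmod_scale (a : S) (p : qmod) : qmod := \pi_qmod (a *: repr p).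

Lemma qmodW (P : qmod -> Prop) : (forall f, P (\pi_qmod f)) -> forall p, P p.
Proof. by move=> Pf p; rewrite -[p]reprK; apply: Pf. Qed.

Lemma qmod_repr (f : V) : gen_congruence (repr (\pi_qmod f)) f.
Proof. by apply/qmodP; rewrite reprK. Qed.

Lemma qmod_addE (f g : V) :
  qmod_add (\pi_qmod f) (\pi_qmod g) = \pi_qmod (f + g).
Proof. by apply/qmodP; apply: (cong_add gen_congruenceP); apply: qmod_repr. Qed.

Lemma qmod_scaleE a (f : V) : qmod_scale a (\pi_qmod f) = \pi_qmod (a *: f).
Proof. by apply/qmodP; apply: (cong_scale gen_congruenceP); apply: qmod_repr. Qed.

Fact qmod_addA : associative qmod_add.
Proof.
elim/qmodW=> f; elim/qmodW=> g; elim/qmodW=> h.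
by rewrite !qmod_addE addrA.
Qed.

Fact qmod_addC : commutative qmod_add.
Proof. by elim/qmodW=> f; elim/qmodW=> g; rewrite !qmod_addE addrC. Qed.

Fact qmod_add0 : left_id qmod_zero qmod_add.
Proof. by elim/qmodW=> f; rewrite qmod_addE add0r. Qed.

HB.instance Definition _ :=
  GRing.isNmodule.Build qmod qmod_addA qmod_addC qmod_add0.

Lemma qmod_piD (f g : V) : \pi_qmod f + \pi_qmod g = \pi_qmod (f + g).
Proof. exact: qmod_addE. Qed.

Fact qmod_scaleA a b p : qmod_scale a (qmod_scale b p) = qmod_scale (a * b) p.
Proof. by elim/qmodW: p => f; rewrite !qmod_scaleE scalerA. Qed.

Fact qmod_scale0 p : qmod_scale 0 p = 0.
Proof. by elim/qmodW: p => f; rewrite qmod_scaleE scale0r. Qed.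

Fact qmod_scale1 : left_id 1 qmod_scale.
Proof. by elim/qmodW=> f; rewrite qmod_scaleE scale1r. Qed.

Fact qmod_scaleDr : right_distributive qmod_scale +%R.
Proof.
move=> a; elim/qmodW=> f; elim/qmodW=> g.
by rewrite qmod_piD !qmod_scaleE qmod_piD scalerDr.
Qed.

Fact qmod_scaleDl p : {morph qmod_scale^~ p : a b / a + b}.
Proof.
elim/qmodW: p => f a b.
by rewrite !qmod_scaleE qmod_piD scalerDl.
Qed.

HB.instance Definition _ := GRing.Nmodule_isLSemiModule.Build S qmod
  qmod_scaleA qmod_scale0 qmod_scale1 qmod_scaleDr qmod_scaleDl.

End QuotientModule.

Definition gen (R : realType) (E : finType) (x : E) : mp_fun R E :=
  [ffun y => if y == x then 1 else 0].

Definition QM_rel (R : realType) (E : finType) (M : valuated_matroid R E)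
    (f g : mp_fun R E) : Prop :=
  exists c x, [/\ circuits M c, f = \sum_y c y *: gen R y &
                  g = \sum_(y | y != x) c y *: gen R y].

Notation QM M := (qmod (QM_rel M)).

Definition QM_gen (R : realType) (E : finType) (M : valuated_matroid R E)
    (x : E) : QM M := \pi_(QM M) (gen R x).

(* Main.v *)
(** An element [q] of [QM M] determines the set of points [hat_pt a x] with
    [a *: QM_gen M x <= q] in the natural order of the idempotent module [QM M].
    The defining relations of [QM M] make this set a flat.  If [q] is the class
    of [g], this flat contains the points of [g], hence their closure; so when
    the closure of [f] is contained in that of [g], the class of [f] is at most
    [q].  This gives injectivity of the map sending the class of [f] to the
    closure of its points. *)
Require Import Defs.
From HB Require Import structures.
From mathcomp Require Import all_boot all_order all_algebra.
From mathcomp Require Import boolp classical_sets cardinality reals.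

Set Implicit Arguments.
Unset Strict Implicit.

Import Order.TTheory GRing.Theory.
Local Open Scope classical_set_scope.
Local Open Scope ring_scope.
Local Open Scope quotient_scope.

Section IdempotentModule.
Context {R : realType} {V : lSemiModType (maxplus R)}.
Implicit Types u v w : V.

Lemma addvv v : v + v = v.
Proof.
rewrite -[in LHS](scale1r v) -scalerDl.
have -> : 1 + 1 = 1 :> maxplus R by exact: maxxx.
by rewrite scale1r.
Qed.

(** Write [w] as [b *: v + w]: the coefficients of [v] add up to [a + b], which is [b]. *)
Lemma scale_absorb (a b : maxplus R) v w :
  a <= b -> b *: v + w = w -> a *: v + w = w.
Proof.
by move=> /max_idPr ab bw; rewrite -[in LHS]bw addrA -scalerDl [a + b]ab bw.
Qed.

Lemma sum_absorb (I : finType) (P : pred I) (F : I -> V) w :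
  (forall i, P i -> F i + w = w) -> \sum_(i | P i) F i + w = w.
Proof.
move=> Fw; apply: (big_ind (fun v => v + w = w)) => //; first by rewrite add0r.
by move=> u v uw vw; rewrite -addrA vw.
Qed.

End IdempotentModule.

Section QuotientModule.
Context {S : pzSemiRingType} {V : lSemiModType S} {r : V -> V -> Prop}.

Fact qmod_pi_semilinear : semilinear (\pi_(qmod r) : V -> qmod r).
Proof. by split=> [a f|f g]; rewrite -?qmod_piD// -qmod_scaleE. Qed.

(** A linear map that identifies both sides of every generating relation thus identifies whatever
    the generated congruence does. *)
Lemma kernel_congruence {W : lSemiModType S} (h : {linear V -> W}) :
  congruence (fun f g => h f = h g).
Proof.
split=> //.
- by move=> f g k -> ->.
- by move=> f g f' g' fg fg'; rewrite !linearD fg fg'.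
- by move=> a f g fg; rewrite !linearZ /= fg.
Qed.

End QuotientModule.

Lemma set_cons_setU (T : eqType) (x : T) (s : seq T) :
  [set` x :: s] = [set x] `|` [set` s].
Proof. by apply/predeqP => y; rewrite /= inE; split => /predU1P. Qed.

Lemma mp_funE (R : realType) (E : finType) (f : mp_fun R E) :
  f = \sum_x f x *: gen R x.
Proof.
apply/ffunP => x; rewrite sum_ffunE (bigD1 x)//= !ffunE eqxx.
rewrite big1 ?addr0 => [|y yx]; first by rewrite [RHS]mulr1.
by rewrite !ffunE eq_sym (negbTE yx); apply: mulr0.
Qed.

Section Iso.
Context {R : realType} {E : finType} (M : valuated_matroid R E).
Implicit Types (f g c : mp_fun R E) (F G : set (hat R E)) (a b : maxplus R).

Lemma cl_hat0 : cl M [set hat0 R E] = cl M set0.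
Proof.
apply/seteqP; split; last by apply: le_cl; exact: sub0set.
by apply: cl_min => [|_ ->]; [exact: flat_cl|apply: flat0; exact: flat_cl].
Qed.

Definition cl_pt (x : E) : fgflat M :=
  FGFlat (flat_cl M [set hat_pt 1 x]) (fg_cl M (finite_set1 _)).

Lemma cl_pt_scaleE a x :
  (a *: cl_pt x : fgflat M) = cl M [set hat_pt a x] :> set _.
Proof.
rewrite /GRing.scale /= /fgflat_scale_set; case: eqVneq => [->|a0].
  by rewrite cl_hat0.
by rewrite cl_image// image_set1 hat_scale_pt mulr1.
Qed.

Lemma cl_pt_sub a x G : is_flat M G ->
  (a *: cl_pt x : fgflat M) `<=` G <-> G (hat_pt a x).
Proof.
move=> fG; rewrite cl_pt_scaleE; split=> [|Gx]; first by apply; apply: sub_cl.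
by apply: cl_min => // _ ->.
Qed.

Lemma fgflat_join_sub (F F' : fgflat M) G : is_flat M G ->
  (F + F' : fgflat M) `<=` G <-> F `<=` G /\ F' `<=` G.
Proof.
move=> fG; split=> [FG|[FG FG']]; last by apply: cl_min; rewrite ?subUset.
by split=> u Fu; apply: FG; apply: sub_cl; [left|right].
Qed.

(** Sums of flats are joins, so a sum is the least flat containing the points of its terms. Testing
    against flats [G] avoids describing its elements. *)
Lemma sum_cl_pt_sub f (P : pred E) G : is_flat M G ->
  (\sum_(x | P x) f x *: cl_pt x : fgflat M) `<=` G <->
  (forall x, P x -> G (hat_pt (f x) x)).
Proof.
move=> fG; split=> [+ x Px|fxG].
  by rewrite (bigD1 x Px) => /(fgflat_join_sub _ _ fG)[/(cl_pt_sub _ _ fG)].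
elim/big_ind: _ => [|F F' FG FG'|x /fxG/(cl_pt_sub _ _ fG)//].
  exact: cl_min.
exact/(fgflat_join_sub _ _ fG).
Qed.

Definition cl_fun f : fgflat M := \sum_x f x *: cl_pt x.

Fact cl_fun_semilinear : semilinear cl_fun.
Proof.
split=> [a f|f g]; rewrite /cl_fun.
  by rewrite scaler_sumr; apply: eq_bigr => x _; rewrite ffunE scalerA.
by rewrite -big_split; apply: eq_bigr => x _; rewrite ffunE scalerDl.
Qed.

HB.instance Definition _ :=
  GRing.isSemilinear.Build _ _ _ _ cl_fun cl_fun_semilinear.

Lemma cl_fun_gen x : cl_fun (gen R x) = cl_pt x.
Proof.
rewrite /cl_fun (bigD1 x)//= big1 => [|y yx].
  by rewrite addr0 ffunE eqxx scale1r.
by rewrite ffunE (negbTE yx) scale0r.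
Qed.

Lemma cl_fun_sum (P : pred E) f :
  cl_fun (\sum_(x | P x) f x *: gen R x) = \sum_(x | P x) f x *: cl_pt x.
Proof.
by rewrite linear_sum; apply: eq_bigr => x _; rewrite linearZ /= cl_fun_gen.
Qed.

(** The sum without the term at [x] is a flat containing the other points of the circuit set; the
    circuit axiom of flats puts [hat_pt (c x) x] in it, so it absorbs that term. *)
Lemma cl_fun_rel f g : QM_rel M f g -> cl_fun f = cl_fun g.
Proof.
move=> [c [x [Mc -> ->]]]; rewrite !cl_fun_sum (bigD1 x)//=.
set G := \sum_(y | y != x) _; rewrite fgflat_join_idPr//.
have fG := fgflat_flat G; apply/(cl_pt_sub _ _ fG).
have [->|cx0] := eqVneq (c x) 0; first exact: flat0 fG.
have /(sum_cl_pt_sub _ _ fG) cG : G `<=` G by [].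
case: (fG) => _ _; apply; [exact: Mc|by exists x|].
move=> _ [[y _ ->] yx]; apply: cG.
by apply: contra_notN yx => /eqP ->.
Qed.

Definition QM_cl (p : QM M) : fgflat M := cl_fun (repr p).

Lemma QM_cl_pi f : QM_cl (\pi_(QM M) f) = cl_fun f.
Proof.
exact: (qmod_repr f (kernel_congruence cl_fun) cl_fun_rel).
Qed.

Fact QM_cl_semilinear : semilinear QM_cl.
Proof.
split=> [a|]; elim/qmodW=> f.
  by rewrite /GRing.scale /= qmod_scaleE !QM_cl_pi linearZ.
by elim/qmodW=> g; rewrite qmod_piD !QM_cl_pi linearD.
Qed.

HB.instance Definition _ :=
  GRing.isSemilinear.Build _ _ _ _ QM_cl QM_cl_semilinear.

Lemma QM_cl_gen x : QM_cl (QM_gen M x) = cl_pt x.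
Proof. by rewrite QM_cl_pi cl_fun_gen. Qed.

HB.instance Definition _ :=
  GRing.isSemilinear.Build _ _ _ _ (\pi_(QM M)) qmod_pi_semilinear.

Lemma QM_pi_sum (P : pred E) f :
  \pi_(QM M) (\sum_(x | P x) f x *: gen R x) =
  \sum_(x | P x) f x *: QM_gen M x.
Proof. by rewrite linear_sum; apply: eq_bigr => x _; rewrite linearZ. Qed.

Lemma QM_piE f : \pi_(QM M) f = \sum_x f x *: QM_gen M x.
Proof. by rewrite [in LHS](mp_funE f) QM_pi_sum. Qed.

(* In an idempotent module, [v <= q] means [v + q = q]. *)
Definition QM_below (q : QM M) : set (hat R E) :=
  [set u | forall a x, u = hat_pt a x -> a *: QM_gen M x + q = q].

(** All pairs with first entry [0] collapse to [hat0], where the condition always holds; any other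
    point determines its pair. *)
Lemma QM_below_pt q a x :
  QM_below q (hat_pt a x) <-> a *: QM_gen M x + q = q.
Proof.
split=> [|aq b y /hat_pt_eq[[_ ->]|[<- <-]]//]; first exact.
by rewrite scale0r add0r.
Qed.

Lemma flat_QM_below q : is_flat M (QM_below q).
Proof.
split.
- by exists (hat0 R E) => -[] // x _; rewrite scale0r add0r.
- move=> u v [[-> ->]//|[x [a [b [-> -> ab]]]]] /QM_below_pt bq.
  exact/QM_below_pt/scale_absorb/bq.
move=> c _ Mc [x cx0 ->] cq; apply/QM_below_pt.
have cxq : \sum_(y | y != x) c y *: QM_gen M y + q = q.
  apply: sum_absorb => y yx; have [->|cy0] := eqVneq (c y) 0.
    by rewrite scale0r add0r.
  apply/QM_below_pt/cq; split; first by exists y.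
  move=> /hat_pt_eq[[cy _]|[_ xy]]; first by rewrite cy eqxx in cy0.
  by rewrite xy eqxx in yx.
(* By the defining relation, the full circuit sum equals the sum without [x], which is already below
   [q]; hence its term at [x] is below [q] too. *)
have <- : \sum_y c y *: QM_gen M y + q = q.
  rewrite -{2}cxq -!QM_pi_sum; congr (_ + q); apply/qmodP => s _; apply.
  by exists c, x.
by rewrite (bigD1 x)//= !addrA addvv.
Qed.

Lemma QM_cl_le p q : QM_cl p `<=` QM_cl q -> p + q = q.
Proof.
elim/qmodW: p => f; elim/qmodW: q => g; rewrite !QM_cl_pi => fg.
have fB := flat_QM_below (\pi g).
rewrite [\pi f]QM_piE; apply: sum_absorb => x _; apply/QM_below_pt.
suff /(sum_cl_pt_sub _ _ fB) : cl_fun f `<=` QM_below (\pi g) by exact.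
apply: (subset_trans fg); apply/(sum_cl_pt_sub _ _ fB) => y _.
(* Each term of [g] is a summand of its class, hence absorbed by idempotence. *)
by apply/QM_below_pt; rewrite QM_piE (bigD1 y)//= addrA addvv.
Qed.

(** Inclusions in both directions make [p] and [q] absorb each other, so both equal [p + q]. *)
Lemma QM_cl_inj : injective QM_cl.
Proof.
move=> p q pq; rewrite -(@QM_cl_le q p) ?pq//.
by rewrite addrC QM_cl_le ?pq.
Qed.

Lemma QM_cl_surj (F : fgflat M) : exists p, QM_cl p = F.
Proof.
case: (fgflat_fg F) => _ /finite_seqP[s ->] FE.
suff [p pE] : exists p, QM_cl p = cl M [set` s] :> set _.
  by exists p; apply: fgflat_inj; rewrite pE.
elim: s {F FE} => [|u s [p pE]]; first by exists 0; rewrite linear0 set_nil.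
(* Induction adds one generating point at a time: [hat0] comes from [0], and [hat_pt a x] from
   [a *: QM_gen M x]. *)
have [q qE] : exists q, QM_cl q = cl M [set u] :> set _.
  case: (hat_ptP u) => [->|[a [x [_ ->]]]].
    by exists 0; rewrite linear0 cl_hat0.
  by exists (a *: QM_gen M x); rewrite -cl_pt_scaleE -QM_cl_gen linearZ.
by exists (q + p); rewrite linearD /= qE pE clU -set_cons_setU.
Qed.

Lemma QM_cl_bij : bijective QM_cl.
Proof.
have [G GK] := choice QM_cl_surj.
by exists G => // p; apply: QM_cl_inj; rewrite GK.
Qed.

End Iso.

Theorem theoremC (R : realType) (E : finType) (M : valuated_matroid R E) :
  exists phi : {linear QM M -> fgflat M},
    [/\ bijective phi,
        forall x : E, phi (QM_gen M x) = cl M [set hat_pt 1 x] :> set (hat R E) &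
        forall psi : {linear QM M -> fgflat M},
          bijective psi ->
          (forall x : E, psi (QM_gen M x) = cl M [set hat_pt 1 x] :> set (hat R E)) ->
          psi =1 phi].
Proof.
exists (@QM_cl R E M); split=> [|x|psi _ psi_gen p]; first exact: QM_cl_bij.
  by rewrite /= QM_cl_gen.
(* The classes [QM_gen M x] span [QM M], so a linear map is determined by its values on them. *)
elim/qmodW: p => f; rewrite QM_piE !linear_sum; apply: eq_bigr => x _.
rewrite !linearZ; congr (_ *: _); apply: fgflat_inj.
by rewrite psi_gen /= QM_cl_gen.
Qed.
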